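(* Consider the censored delayed-feedback bandit model with threshold $m\ge 1$ (described in the context), with conversion rates $\theta=(\theta_1,\dots,\theta_K)\in(0,1)^K$ such that arm $1$ is the unique optimal arm ($\theta^*:=\theta_1>\theta_k$ for all $k\neq 1$), and with a delay distribution whose CDF satisfies $\tau_m>0$. Then every uniformly efficient algorithm satisfies \[ \liminf_{T\to\infty}\frac{L(T)}{\log T}\;\ge\;\sum_{k\neq 1}\frac{\tau_m(\theta^*-\theta_k)}{d(\tau_m\theta_k,\tau_m\theta^* )} . \]
   Context: Delayed-feedback bandit model: there are $K$ arms with unknown conversion rates $\theta_1,\dots,\theta_K\in[0,1]$, and a known delay distribution on $\mathbb{N}=\{0,1,2,\dots\}$ with CDF $\tau_d=\mathbb{P}(D\le d)$, $d\ge 0$. At each round $t=1,2,\dots$ the learner chooses an arm $A_t\in\{1,\dots,K\}$ as a function of the observations available before round $t$. This triggers $C_t\in\{0,1\}$ and $D_t\in\mathbb{N}$ which, conditionally on the past, are independent, with $C_t\sim\mathrm{Bernoulli}(\theta_{A_t})$ and $D_t$ distributed with CDF $\tau$. For $s\le t$ let $X_{s,t}=C_s\mathbf{1}\{D_s\le t-s\}$. In the censored model with threshold $m$, at round $t$ the learner observes $X_{s,t}$ only for $t-m\le s\le t$, and receives reward $Y_t=\sum_{s=t-m}^{t}C_s\mathbf{1}\{D_s=t-s\}$. The expected regret is $L(T)=\mathbb{E}[r^*(T)-r(T)]$ where $r(T)=\sum_{t=1}^T Y_t$ and $r^*(T)$ is the cumulated reward of an oracle playing the optimal arm at every round. An algorithm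 is uniformly efficient if for every bandit model (every parameter vector $\theta$) and every $\alpha\in(0,1)$, $L(T)/T^\alpha\to 0$ as $T\to\infty$. $d(p,q)=p\log(p/q)+(1-p)\log((1-p)/(1-q))$ denotes the Bernoulli Kullback–Leibler divergence. *)

(* Defs.v *)
From HB Require Import structures.
From mathcomp Require Import all_boot all_order all_algebra.
From mathcomp Require Import all_classical all_reals all_analysis.
Set Implicit Arguments. Unset Strict Implicit. Unset Printing Implicit Defensive.
Import Order.TTheory GRing.Theory Num.Theory.
Import numFieldNormedType.Exports.
Local Open Scope classical_set_scope.
Local Open Scope ring_scope.

(* Censored delayed-feedback bandit with K arms (indexed by 'I_K) and       *)
(* censoring threshold m.  Rounds are numbered 0,1,2,... (round t here is   *)
(* round t+1 of the paper).                                                 *)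
(* Only the truncated delay min(D_s, m+1) ever influences observations and  *)
(* rewards (observations X_{s,t} are only made for t-s <= m, and rewards     *)
(* only involve 1{D_s = t-s} with t-s <= m), so a delay is represented by    *)
(* an element of 'I_(m.+2), the value m+1 standing for the event D > m.     *)

Section Model.
Variables (R : realType) (K m : nat).

(* Probability mass of the truncated delay, from the CDF tau:
   P(D = d) = tau d - tau (d-1) for d <= m (tau(-1) = 0), P(D > m) = 1 - tau m *)
Definition delay_pmf (tau : nat -> R) (d : 'I_m.+2) : R :=
  if (d : nat) == m.+1 then 1 - tau m
  else if (d : nat) is d'.+1 then tau d - tau d' else tau 0%N.

Definition bern_pmf (p : R) (c : bool) : R := if c then p else 1 - p.

(* A history: for every past round u, the arm played and the vector of
   observations (X_{s,u})_{max(0,u-m) <= s <= u} made at round u. *)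
Definition history := seq ('I_K * seq bool).

Definition policy := history -> 'I_K.

(* An outcome: the pairs (C_s, min(D_s, m+1)) for all rounds s. *)
Definition outcome := nat -> bool * 'I_m.+2.

Definition Cof (w : outcome) (s : nat) : bool := (w s).1.
Definition Dof (w : outcome) (s : nat) : nat := (w s).2.

Definition Xobs (w : outcome) (s t : nat) : bool :=
  Cof w s && (Dof w s <= t - s)%N.

Definition obs_at (w : outcome) (t : nat) : seq bool :=
  [seq Xobs w s t | s <- iota (t - m) (t - (t - m)).+1].

Fixpoint hist (pol : policy) (w : outcome) (t : nat) : history :=
  if t is t'.+1 then
    rcons (hist pol w t') (pol (hist pol w t'), obs_at w t')
  else [::].

Definition arm (pol : policy) (w : outcome) (t : nat) : 'I_K :=
  pol (hist pol w t).

Definition reward (w : outcome) (t : nat) : R :=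
  \sum_(t - m <= s < t.+1) ((Cof w s && (Dof w s == t - s)%N)%:R : R).

Definition cumreward (w : outcome) (T : nat) : R :=
  \sum_(t < T) reward w t.

Definition ext (T : nat) (f : {ffun 'I_T -> bool * 'I_m.+2}) : outcome :=
  fun s => if insub s is Some i then f i else (false, ord0).

(* probability of the first T coordinates (C_s, D_s)_{s<T} under algorithm
   pol: conditionally on the past, C_s ~ Bernoulli(theta_{A_s}) and D_s ~ tau
   are independent, so the joint law is the product of the conditionals. *)
Definition traj_prob (theta : 'I_K -> R) (tau : nat -> R) (pol : policy)
  (T : nat) (f : {ffun 'I_T -> bool * 'I_m.+2}) : R :=
  \prod_(i < T) (bern_pmf (theta (arm pol (ext f) i)) (f i).1 * delay_pmf tau (f i).2).

Definition exp_reward (theta : 'I_K -> R) (tau : nat -> R) (pol : policy)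
  (T : nat) : R :=
  \sum_(f : {ffun 'I_T -> bool * 'I_m.+2})
     traj_prob theta tau pol f * cumreward (ext f) T.

(* an optimal arm (arg max of theta; i0 is only a default for arg max) *)
Definition opt_arm (i0 : 'I_K) (theta : 'I_K -> R) : 'I_K :=
  [arg max_(k > i0) theta k]%O.

Definition regret (i0 : 'I_K) (theta : 'I_K -> R) (tau : nat -> R)
  (pol : policy) (T : nat) : R :=
  exp_reward theta tau (fun _ => opt_arm i0 theta) T - exp_reward theta tau pol T.

Definition uniformly_efficient (i0 : 'I_K) (tau : nat -> R) (pol : policy) :=
  forall theta : 'I_K -> R, (forall k, 0 <= theta k <= 1) ->
  forall alpha : R, 0 < alpha < 1 ->
    (fun T : nat => regret i0 theta tau pol T / (T%:R `^ alpha)) @ \oo --> (0 : R).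

End Model.

Definition kl (R : realType) (p q : R) : R :=
  p * ln (p / q) + (1 - p) * ln ((1 - p) / (1 - q)).

Definition is_cdf (R : realType) (tau : nat -> R) : Prop :=
  (forall d, 0 <= tau d) /\ (forall d, tau d <= tau d.+1) /\
  (forall d, tau d <= 1) /\ tau @ \oo --> (1 : R).

(* Main.v *)
(* Fix a suboptimal arm k and let theta' be theta with the k-th rate raised just
   above theta_best.  By efficiency, under theta' the rounds not spent on k number
   O(T^alpha), whereas under theta arm k is played o(T) times.  Telling these two
   laws apart requires, up to o(log T), (1 - alpha) log T units of relative entropy,
   and each play of k supplies exactly d(tau_m theta_k, tau_m theta'_k) since a
   censored or absent conversion is a single outcome of mass 1 - tau_m theta_k.
   Let theta'_k tend to theta_best, then alpha to 0; finally, delays make the regret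
   differ from tau_m sum_k (theta_best - theta_k) E N_k(T) by at most m. *)
Require Import Defs.
From HB Require Import structures.
From mathcomp Require Import all_boot all_order all_algebra.
From mathcomp Require Import all_classical all_reals all_analysis.
From mathcomp Require Import ring lra.
Import Order.TTheory GRing.Theory Num.Theory.
Import numFieldNormedType.Exports.
Local Open Scope classical_set_scope.
Local Open Scope ring_scope.
Set Implicit Arguments.
Unset Strict Implicit.
Unset Printing Implicit Defensive.

(** * Expectations along a trajectory *)

Section PathExpectation.
Variables (R : realType) (m : nat).
Local Notation X := (bool * 'I_m.+2)%type.
Implicit Types (w : outcome m) (h g : outcome m -> R) (x : X).

Definition upd w t x : outcome m := fun s => if s == t then x else w s.

Definition adapted (B : Type) (F : outcome m -> nat -> B) :=
  forall w w' t, (forall s, (s < t)%N -> w s = w' s) -> F w t = F w' t.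

Lemma adapted_upd (B : Type) (F : outcome m -> nat -> B) w t T x :
  adapted F -> (t <= T)%N -> F (upd w T x) t = F w t.
Proof.
move=> Fa tT; apply: Fa => s st; rewrite /upd.
by case: eqP => // sT; move: (leq_trans st tT); rewrite sT ltnn.
Qed.

(** Iterated conditional expectation: the last round is integrated first, [p w t] being the law of
    round [t] given the past. The base outcome agrees with the default value of [ext]. *)
Fixpoint Ex (p : outcome m -> nat -> X -> R) (T : nat) h : R :=
  if T is t.+1 then Ex p t (fun w => \sum_x p w t x * h (upd w t x))
  else h (fun=> (false, ord0)).

Definition ffrcons T (f : {ffun 'I_T -> X}) x : {ffun 'I_T.+1 -> X} :=
  [ffun i => if unlift ord_max i is Some j then f j else x].

Lemma ext_ffrcons T (f : {ffun 'I_T -> X}) x :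
  ext (ffrcons f x) = upd (ext f) T x.
Proof.
apply/funext => s; rewrite /ext /upd.
case: insubP => [i _ <-|].
  rewrite ffunE; case: unliftP => [j ->|->]; last by rewrite eqxx.
  rewrite (_ : val (lift ord_max j) = j); last exact: lift_max.
  rewrite (ltn_eqF (ltn_ord j)).
  case: insubP => [j' _ /val_inj ->//|]; by rewrite ltn_ord.
rewrite -leqNgt => Ts; rewrite (gtn_eqF Ts).
by case: insubP => // i; rewrite ltnNge (ltnW Ts).
Qed.

Lemma sum_ffrcons T (F : {ffun 'I_T.+1 -> X} -> R) :
  \sum_f F f = \sum_(f : {ffun 'I_T -> X}) \sum_x F (ffrcons f x).
Proof.
rewrite pair_big /=; symmetry.
rewrite (reindex (fun u : {ffun 'I_T -> X} * X => ffrcons u.1 u.2)) //=.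
exists (fun f : {ffun 'I_T.+1 -> X} =>
  ([ffun j => f (lift ord_max j)], f ord_max)) => [[f x] _|f _] /=.
  congr pair; last by rewrite ffunE unlift_none.
  by apply/ffunP => j; rewrite !ffunE liftK.
apply/ffunP => i; rewrite !ffunE; case: unliftP => [j ->|-> //].
by rewrite ffunE.
Qed.

(** Links sums over finite trajectories, the form of [exp_reward], to [Ex]. Induction peels off the
    last coordinate, which an adapted kernel at earlier rounds cannot see. *)
Lemma Ex_ffun p T h : adapted p ->
  \sum_(f : {ffun 'I_T -> X}) (\prod_(i < T) p (ext f) i (f i)) * h (ext f)
  = Ex p T h.
Proof.
move=> pa; elim: T h => [|T IH] h.
  rewrite (eq_bigr (fun=> h (fun=> (false, ord0)))) => [|f _].
    by rewrite big_const card_ffun card_ord expn0 /= addr0.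
  rewrite big_ord0 mul1r; congr h; apply/funext => s.
  by rewrite /ext; case: insubP.
rewrite sum_ffrcons /= -IH; apply: eq_bigr => f _.
rewrite mulr_sumr; apply: eq_bigr => x _.
rewrite ext_ffrcons big_ord_recr /= mulrA; congr (_ * _ * _).
  apply: eq_bigr => i _; rewrite (adapted_upd _ _ pa (ltnW (ltn_ord i))).
  rewrite ffunE (_ : widen_ord _ i = lift ord_max i) ?liftK//.
  exact/val_inj/esym/lift_max.
by rewrite adapted_upd// ffunE unlift_none.
Qed.

Lemma eq_Ex p T h g : h =1 g -> Ex p T h = Ex p T g.
Proof. by move=> /funext ->. Qed.

Lemma ExD p T h g : Ex p T (fun w => h w + g w) = Ex p T h + Ex p T g.
Proof.
elim: T h g => //= T IH h g; rewrite -IH; apply: eq_Ex => w.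
by rewrite -big_split; apply: eq_bigr => x _; rewrite mulrDr.
Qed.

Lemma ExZ p T (a : R) h : Ex p T (fun w => a * h w) = a * Ex p T h.
Proof.
elim: T h => //= T IH h; rewrite -IH; apply: eq_Ex => w.
by rewrite mulr_sumr; apply: eq_bigr => x _; rewrite mulrCA.
Qed.

Lemma Ex0 p T : Ex p T (fun=> 0) = 0.
Proof.
elim: T => //= T IH; rewrite -[RHS]IH; apply: eq_Ex => w.
by rewrite big1 // => x _; rewrite mulr0.
Qed.

Lemma ExB p T h g : Ex p T (fun w => h w - g w) = Ex p T h - Ex p T g.
Proof.
by rewrite -mulN1r -ExZ -ExD; apply: eq_Ex => w; rewrite mulN1r.
Qed.

Lemma Ex_sum p T (I : Type) (r : seq I) (P : pred I) (F : I -> outcome m -> R) :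
  Ex p T (fun w => \sum_(i <- r | P i) F i w) =
  \sum_(i <- r | P i) Ex p T (F i).
Proof.
elim: r => [|i r IH].
  rewrite big_nil -[RHS](Ex0 p T); apply: eq_Ex => w; by rewrite big_nil.
rewrite big_cons -IH; case: ifP => Pi; last first.
  by apply: eq_Ex => w; rewrite big_cons Pi.
by rewrite -ExD; apply: eq_Ex => w; rewrite big_cons Pi.
Qed.

Section Kernel.
Variable p : outcome m -> nat -> X -> R.
Hypothesis p_ge0 : forall w t x, 0 <= p w t x.
Hypothesis p_sum1 : forall w t, \sum_x p w t x = 1.

Lemma le_Ex T h g : (forall w, h w <= g w) -> Ex p T h <= Ex p T g.
Proof.
elim: T h g => //= T IH h g hg; apply: IH => w.
by apply: ler_sum => x _; rewrite ler_wpM2l.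
Qed.

Lemma Ex_cst T (a : R) : Ex p T (fun=> a) = a.
Proof.
elim: T a => //= T IH a; rewrite -[RHS]IH; apply: eq_Ex => w.
by rewrite -mulr_suml p_sum1 mul1r.
Qed.

Lemma Ex_past T h : (forall w x, h (upd w T x) = h w) -> Ex p T.+1 h = Ex p T h.
Proof.
move=> hu /=; apply: eq_Ex => w.
under eq_bigr => x _ do rewrite hu.
by rewrite -mulr_suml p_sum1 mul1r.
Qed.

End Kernel.
End PathExpectation.

(** * Censored observations and change of measure *)

Section BanditKernel.
Variables (R : realType) (K m : nat) (tau : nat -> R) (pol : policy K).
Hypothesis tau_cdf : is_cdf tau.
Local Notation X := (bool * 'I_m.+2)%type.
Implicit Types (w : outcome m) (x : X) (theta : 'I_K -> R).

(* What the learner eventually learns about a round: the delay of an observed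
   conversion, or [m.+1] when there is no conversion or it is censored. *)
Definition seen x : nat := if x.1 then nat_of_ord x.2 else m.+1.

(** At a lag of at most [m], [Xobs] is the test that [seen] is at most the lag, and the value [m.+1]
    always fails it. So no policy can separate a censored conversion from an absent one. *)
Lemma hist_seen w w' t : (forall s, (s < t)%N -> seen (w s) = seen (w' s)) ->
  hist pol w t = hist pol w' t.
Proof.
elim: t => //= t IH ww'.
rewrite IH => [|s st]; last exact/ww'/ltnW.
congr (rcons _ (_, _)); apply/eq_in_map => s.
rewrite mem_iota addnS ltnS => /andP[ms st].
have {}st : (s <= t)%N by rewrite -(subnKC (leq_subr m t)).
have ts : (t - s <= m)%N by rewrite leq_subLR addnC -leq_subLR.
have XobsE u : Xobs u s t = (seen (u s) <= t - s)%N.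
  rewrite /Xobs /Cof /Dof /seen; case: (u s).1 => //=.
  by symmetry; apply/negbTE; rewrite -ltnNge ltnS.
by rewrite !XobsE ww'.
Qed.

Lemma arm_seen w w' t : (forall s, (s < t)%N -> seen (w s) = seen (w' s)) ->
  arm pol w t = arm pol w' t.
Proof. by rewrite /arm => /hist_seen ->. Qed.

Lemma adapted_arm : adapted (arm pol : outcome m -> nat -> 'I_K).
Proof. by move=> w w' t ww'; apply: arm_seen => s st; rewrite ww'. Qed.

Definition dmass (d : nat) : R := if d is d'.+1 then tau d - tau d' else tau 0%N.

Lemma dmass_ge0 d : 0 <= dmass d.
Proof.
have [t0 [tS _]] := tau_cdf.
by case: d => [|d] /=; rewrite ?subr_ge0.
Qed.

Lemma sum_dmass n : \sum_(d < n.+1) dmass d = tau n.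
Proof.
elim: n => [|n IH]; first by rewrite big_ord_recl big_ord0 addr0.
by rewrite big_ord_recr IH /= addrC subrK.
Qed.

(** Conditional law of the pair (C, D) of round [t] given the past; its product along a trajectory
    is [traj_prob]. *)
Definition pk theta w t x : R :=
  bern_pmf (theta (arm pol w t)) x.1 * delay_pmf tau x.2.

Lemma adapted_pk theta : adapted (pk theta).
Proof. by move=> w w' t /adapted_arm ww'; rewrite /pk ww'. Qed.

Lemma delay_pmf_ge0 (d : 'I_m.+2) : 0 <= delay_pmf tau d.
Proof.
rewrite /delay_pmf; case: eqP => _; last exact: dmass_ge0.
by case: tau_cdf => _ [_ [t1 _]]; rewrite subr_ge0.
Qed.

Lemma sum_bern_delay (q : R) (G : X -> R) :
  \sum_x bern_pmf q x.1 * delay_pmf tau x.2 * G x =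
  \sum_(d < m.+1) dmass d *
    (q * G (true, widen_ord (leqnSn _) d) +
     (1 - q) * G (false, widen_ord (leqnSn _) d))
  + (1 - tau m) * (q * G (true, ord_max) + (1 - q) * G (false, ord_max)).
Proof.
rewrite (eq_bigr (fun x => bern_pmf q x.1 * delay_pmf tau x.2 * G (x.1, x.2)));
  last by case.
rewrite -(pair_bigA _ (fun c d => bern_pmf q c * delay_pmf tau d * G (c, d))) /=.
rewrite big_bool /= -big_split /= big_ord_recr /=; congr (_ + _).
  apply: eq_bigr => d _.
  have -> : delay_pmf tau (widen_ord (leqnSn m.+1) d) = dmass d.
    by rewrite /delay_pmf /= (ltn_eqF (ltn_ord d)).
  by ring.
by rewrite /delay_pmf /= eqxx; ring.
Qed.

Lemma sum_bern_delay1 (q : R) :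
  \sum_(x : X) bern_pmf q x.1 * delay_pmf tau x.2 = 1.
Proof.
have := sum_bern_delay q (fun=> 1).
under eq_bigr => x _ do rewrite mulr1.
move=> ->; under eq_bigr => d _ do rewrite !mulr1 addrC subrK mulr1.
by rewrite sum_dmass; ring.
Qed.

(** Absent and censored conversions share one value of [seen], so they merge into a single atom of
    mass (1 - q) + q (1 - [tau m]) = 1 - [tau m] q. *)
Lemma sum_bern_seen (q : R) (G : X -> R) :
  (forall x y, seen x = seen y -> G x = G y) ->
  \sum_x bern_pmf q x.1 * delay_pmf tau x.2 * G x =
  q * (\sum_(d < m.+1) dmass d * G (true, widen_ord (leqnSn _) d))
  + (1 - tau m * q) * G (true, ord_max).
Proof.
move=> Gs; rewrite sum_bern_delay.
have Gf d : G (false, d) = G (true, ord_max) by apply: Gs.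
rewrite (eq_bigr (fun d : 'I_m.+1 => q * (dmass d * G (true, widen_ord (leqnSn _) d)) +
    dmass d * ((1 - q) * G (true, ord_max)))) => [|d _]; last by rewrite Gf; ring.
rewrite big_split /= -mulr_sumr -mulr_suml sum_dmass Gf; ring.
Qed.

Lemma sum_conv_delay (q : R) (e : nat) : (e <= m)%N ->
  \sum_(x : X) bern_pmf q x.1 * delay_pmf tau x.2 *
     (x.1 && ((x.2 : nat) == e))%:R = q * dmass e.
Proof.
move=> em; rewrite sum_bern_delay /= (gtn_eqF (_ : (e < m.+1)%N))//.
rewrite !mulr0 !addr0 mulr0 addr0.
rewrite (bigD1 (Ordinal (em : (e < m.+1)%N))) //= eqxx big1 => [|d de].
  by rewrite !addr0 mulr1 mulrC.
rewrite (_ : (_ == e) = false) ?mulr0 ?addr0 ?mulr0//.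
by apply: contraNF de => /eqP de; apply/eqP/val_inj.
Qed.

Lemma pk_ge0 theta w t x : (forall k, 0 <= theta k <= 1) -> 0 <= pk theta w t x.
Proof.
move=> th; rewrite mulr_ge0 ?delay_pmf_ge0// /bern_pmf.
by have /andP[? ?] := th (arm pol w t); case: ifP; rewrite ?subr_ge0.
Qed.

Lemma pk_sum1 theta w t : \sum_x pk theta w t x = 1.
Proof. exact: sum_bern_delay1. Qed.

(* Log-likelihood ratio of [seen], not of the pair (C, D): the resulting divergence
   is d(tau_m theta, tau_m theta') rather than d(theta, theta'). *)
Definition llr theta theta' (k : 'I_K) x : R :=
  if (seen x <= m)%N then ln (theta' k / theta k)
  else ln ((1 - tau m * theta' k) / (1 - tau m * theta k)).

Definition loglik theta theta' w T : R :=
  \sum_(s < T) llr theta theta' (arm pol w s) (w s).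

Lemma loglik_upd theta theta' w T x :
  loglik theta theta' (upd w T x) T.+1 =
  loglik theta theta' w T + llr theta theta' (arm pol w T) x.
Proof.
rewrite /loglik big_ord_recr /= (adapted_upd _ _ adapted_arm) //.
rewrite [upd w T x T](_ : _ = x); last by rewrite /upd eqxx.
congr (_ + _); apply: eq_bigr => s _.
rewrite (adapted_upd _ _ adapted_arm) ?(ltnW (ltn_ord s))//.
by rewrite /upd (ltn_eqF (ltn_ord s)).
Qed.

Section ChangeOfMeasure.
Variables theta theta' : 'I_K -> R.
Hypothesis th : forall k, 0 < theta k < 1.
Hypothesis th' : forall k, 0 < theta' k < 1.
Hypothesis tau_gt0 : 0 < tau m.

Let tau_le1 : tau m <= 1.
Proof. by case: tau_cdf => _ [_ [t1 _]]. Qed.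

Lemma tau_mul_lt1 (q : R) : 0 < q < 1 -> 0 < 1 - tau m * q.
Proof.
move=> /andP[q0 q1]; rewrite subr_gt0 (le_lt_trans _ q1)//.
by rewrite ler_piMl// ltW.
Qed.

Lemma llr_seen k x y : seen x = seen y ->
  llr theta theta' k x = llr theta theta' k y.
Proof. by rewrite /llr => ->. Qed.

(** On the classes of [seen], [expR] of [llr] is exactly the ratio of the two masses: the delay mass
    cancels for an observed conversion, and the merged atom has mass 1 - [tau m] q. *)
Lemma step_change w t (H : X -> R) :
  (forall x y, seen x = seen y -> H x = H y) ->
  \sum_x pk theta' w t x * H x =
  \sum_x pk theta w t x * (expR (llr theta theta' (arm pol w t) x) * H x).
Proof.
move=> Hs; rewrite !sum_bern_seen//; last first.
  by move=> x y xy; rewrite (llr_seen _ xy) (Hs _ _ xy).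
set k := arm pol w t.
have [/andP[q0 q1] /andP[q0' q1']] := (th k, th' k).
rewrite {2}/llr /seen /= ltnn lnK ?posrE ?divr_gt0 ?tau_mul_lt1 ?th ?th'//.
congr (_ + _).
  rewrite !mulr_sumr; apply: eq_bigr => d _.
  rewrite /llr /seen /= -ltnS ltn_ord lnK ?posrE ?divr_gt0//.
  by field; rewrite gt_eqF.
by field; rewrite gt_eqF ?tau_mul_lt1 ?th.
Qed.

Lemma step_kl w t :
  \sum_x pk theta w t x * llr theta theta' (arm pol w t) x =
  - kl (tau m * theta (arm pol w t)) (tau m * theta' (arm pol w t)).
Proof.
rewrite sum_bern_seen; last exact: llr_seen.
set k := arm pol w t.
have [/andP[q0 q1] /andP[q0' q1']] := (th k, th' k).
rewrite {2}/llr /seen /= ltnn.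
under eq_bigr => d _ do rewrite /llr /seen /= -ltnS ltn_ord.
rewrite -mulr_suml sum_dmass /kl.
(* The factor [tau m] cancels between numerator and denominator; inverting the other ratios below
   produces the minus sign, since [llr] is the log-ratio of [theta'] to [theta]. *)
have -> : tau m * theta k / (tau m * theta' k) = theta k / theta' k.
  by rewrite -mulf_div divff ?mul1r// gt_eqF.
rewrite -[theta' k / _]invf_div -[(1 - _ * theta' k) / _]invf_div !lnV; last first.
- by rewrite posrE divr_gt0.
- by rewrite posrE divr_gt0 ?tau_mul_lt1 ?th ?th'.
by ring.
Qed.

Lemma change_of_measure T (H : outcome m -> R) :
  (forall w w', (forall s, (s < T)%N -> seen (w s) = seen (w' s)) -> H w = H w') ->
  Ex (pk theta') T H = Ex (pk theta) T (fun w => expR (loglik theta theta' w T) * H w).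
Proof.
elim: T H => [|T IH] H Hs /=; first by rewrite /loglik big_ord0 expR0 mul1r.
have seen_upd w w' x y : (forall s, (s < T)%N -> seen (w s) = seen (w' s)) ->
    seen x = seen y ->
    forall s, (s < T.+1)%N -> seen (upd w T x s) = seen (upd w' T y s).
  move=> ww' xy s; rewrite ltnS leq_eqVlt /upd; case: eqP => //= _; exact: ww'.
rewrite IH => [|w w' ww'].
  apply: eq_Ex => w; rewrite step_change => [|x y xy]; last first.
    exact/Hs/seen_upd.
  rewrite mulr_sumr; apply: eq_bigr => x _.
  by rewrite loglik_upd expRD mulrCA !mulrA.
(* The induction hypothesis needs the function averaged over the last round to depend on the past
   through [seen] only; the kernel does so because the arm does. *)
apply: eq_bigr => x _; rewrite /pk (arm_seen ww'); congr (_ * _).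
exact/Hs/seen_upd.
Qed.

(** Chain rule for relative entropy: given the past, each round adds on average minus the divergence
    of the arm just played. Grouping rounds by arm then brings out the expected counts. *)
Lemma Ex_loglik T :
  Ex (pk theta) T (fun w => loglik theta theta' w T) =
  - \sum_k kl (tau m * theta k) (tau m * theta' k) *
      Ex (pk theta) T (fun w => \sum_(s < T) (arm pol w s == k)%:R).
Proof.
pose D k := kl (tau m * theta k) (tau m * theta' k).
transitivity (- Ex (pk theta) T (fun w => \sum_(s < T) D (arm pol w s))).
  elim: T => [|T IH] /=; first by rewrite /loglik !big_ord0 oppr0.
  transitivity (Ex (pk theta) T (fun w => loglik theta theta' w T - D (arm pol w T))).
    apply: eq_Ex => w; rewrite -step_kl.
    under eq_bigr => x _ do rewrite loglik_upd mulrDr.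
    by rewrite big_split /= -mulr_suml pk_sum1 mul1r.
  rewrite ExB IH -opprD -ExD; congr (- _); apply: eq_Ex => w.
  rewrite -[LHS]mul1r -(pk_sum1 theta w T) mulr_suml.
  apply: eq_bigr => x _; rewrite big_ord_recr /=; congr (_ * (_ + D _)).
    by apply: eq_bigr => s _; rewrite (adapted_upd _ _ adapted_arm)// ltnW.
  by rewrite (adapted_upd _ _ adapted_arm).
congr (- _); under [RHS]eq_bigr => k _ do rewrite -ExZ.
rewrite -Ex_sum; apply: eq_Ex => w.
under [RHS]eq_bigr => k _ do rewrite mulr_sumr.
rewrite exchange_big; apply: eq_bigr => s _.
rewrite (bigD1 (arm pol w s)) //= eqxx mulr1 big1 ?addr0// => k.
by rewrite eq_sym => /negbTE ->; rewrite mulr0.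
Qed.

End ChangeOfMeasure.
End BanditKernel.

(** * Regret and numbers of plays *)

Section RegretBounds.
Variables (R : realType) (K m : nat) (tau : nat -> R).
Hypothesis tau_cdf : is_cdf tau.

Definition plays (pol : policy K) (theta : 'I_K -> R) (T : nat) (k : 'I_K) : R :=
  Ex (pk (m := m) tau pol theta) T (fun w => \sum_(s < T) (arm pol w s == k)%:R).

Lemma kl_id (p : R) : 0 < p < 1 -> kl p p = 0.
Proof.
move=> /andP[p0 p1]; rewrite /kl !divff ?ln1 ?mulr0 ?addr0//.
  by rewrite gt_eqF// subr_gt0.
by rewrite gt_eqF.
Qed.

Section Policy.
Variable pol : policy K.
Local Notation Ek theta := (Ex (pk (m := m) tau pol theta)).

Lemma sum_plays theta T : \sum_k plays pol theta T k = T%:R.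
Proof.
rewrite -Ex_sum -[RHS](Ex_cst (fun w t => pk_sum1 (m := m) tau pol theta w t) T).
apply: eq_Ex => w; rewrite exchange_big /= -[in RHS](card_ord T) -sumr_const.
apply: eq_bigr => s _; rewrite (bigD1 (arm pol w s)) //= eqxx big1 ?addr0// => k.
by rewrite eq_sym => /negbTE ->.
Qed.

Lemma plays_ge0 theta T k : (forall j, 0 <= theta j <= 1) ->
  0 <= plays pol theta T k.
Proof.
move=> th; rewrite -(Ex0 (pk (m := m) tau pol theta) T); apply: le_Ex => [w t x|w].
  exact: pk_ge0.
by apply: sumr_ge0.
Qed.

(** Rounds after [s] integrate to 1. At round [s] itself the arm is already fixed by the past, and
    conversion and delay are independent given it. *)
Lemma Ex_conversion theta T s e : (s < T)%N -> (e <= m)%N ->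
  Ek theta T (fun w => ((w s).1 && ((w s).2 == e :> nat))%:R) =
  dmass tau e * Ek theta T (fun w => theta (arm pol w s)).
Proof.
move=> + em; elim: T => // T IH; rewrite ltnS leq_eqVlt => /predU1P[->{s IH}|sT].
  rewrite [in RHS]Ex_past; last first.
  - by move=> w x; rewrite (adapted_upd _ _ (adapted_arm _)).
  - by move=> w t; apply: pk_sum1.
  rewrite /= -ExZ; apply: eq_Ex => w; rewrite mulrC -(sum_conv_delay _ _ em).
  by apply: eq_bigr => x _; rewrite /upd eqxx.
rewrite !Ex_past ?IH//; try by move=> w t; apply: pk_sum1.
- by move=> w x; rewrite (adapted_upd _ _ (adapted_arm _))// ltnW.
- by move=> w x; rewrite /upd ltn_eqF.
Qed.

Lemma exp_rewardE theta T :
  exp_reward m theta tau pol T =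
  \sum_(t < T) \sum_(t - m <= s < t.+1)
     dmass tau (t - s) * Ek theta T (fun w => theta (arm pol w s)).
Proof.
transitivity (Ek theta T (fun w => cumreward R w T)).
  by rewrite -Ex_ffun//; apply: adapted_pk.
rewrite Ex_sum; apply: eq_bigr => t _; rewrite Ex_sum.
rewrite big_nat_cond [RHS]big_nat_cond; apply: eq_bigr => s.
rewrite andbT => /andP[ms st]; apply: Ex_conversion.
  by rewrite (leq_trans st).
by rewrite leq_subLR addnC -leq_subLR.
Qed.

(* Gibbs' variational inequality: for [off_k] = 1{A_t <> k}, apply [1 + x <= expR x]
   to [x = a * off_k + loglik], take expectations under [theta], and average over
   [t].  With [a = (1 - alpha) ln T] this is the logarithmic lower bound. *)
Lemma exploration_bound (theta theta' : 'I_K -> R) (k : 'I_K) (a : R) T :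
  0 < tau m ->
  (forall j, 0 < theta j < 1) -> (forall j, 0 < theta' j < 1) ->
  (forall j, j != k -> theta' j = theta j) ->
  a * (T%:R - plays pol theta T k)
    - T%:R * (kl (tau m * theta k) (tau m * theta' k) * plays pol theta T k)
  <= expR a * (T%:R - plays pol theta' T k).
Proof.
move=> tau0 th th' off.
have tau1 : tau m <= 1 by case: tau_cdf => _ [_ []].
pose off_k t (w : outcome m) : R := (arm pol w t != k)%:R.
have offE th0 : T%:R - plays pol th0 T k = \sum_(t < T) Ek th0 T (off_k t).
  rewrite -{1}(Ex_cst (fun w t => pk_sum1 (m := m) tau pol th0 w t) T T%:R).
  rewrite -ExB -Ex_sum; apply: eq_Ex => w.
  rewrite -[X in X%:R - _](card_ord T) -sumr_const -sumrB.
  by apply: eq_bigr => t _; rewrite /off_k; case: eqP => _ /=; rewrite ?subrr ?subr0.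
rewrite !offE [X in X%:R * _](_ : T = #|'I_T|); last by rewrite card_ord.
rewrite mulr_natl -sumr_const !mulr_sumr -sumrB; apply: ler_sum => t _.
(* The two models differ at arm [k] only, so the other arms contribute zero divergence. *)
have -> : kl (tau m * theta k) (tau m * theta' k) * plays pol theta T k =
    - Ek theta T (fun w => loglik tau pol theta theta' w T).
  rewrite Ex_loglik// opprK (bigD1 k)//= big1 ?addr0// => j jk.
  rewrite off// kl_id ?mul0r//.
  have /andP[t0 t1] := th j; rewrite mulr_gt0//=.
  by rewrite (le_lt_trans _ t1)// ler_piMl// ltW.
rewrite opprK -ExZ -ExD.
(* The added 1 prepares the bound exp(a * off) <= 1 + exp(a) * off, valid because [off_k] is 0 or 1;
   it later cancels the 1 of 1 + x <= exp(x). *)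
have -> : expR a * Ek theta' T (off_k t) =
    Ek theta' T (fun w => 1 + expR a * off_k t w) - 1.
  rewrite ExD ExZ Ex_cst; first by rewrite addrC addKr.
  by move=> w s; apply: pk_sum1.
rewrite (change_of_measure pol tau_cdf th th'); last first.
  move=> w w' ww'; rewrite /off_k (@arm_seen _ _ _ w w')// => s st.
  by apply: ww'; rewrite (ltn_trans st).
rewrite lerBrDr -[X in _ + X](Ex_cst (fun w t => pk_sum1 (m := m) tau pol theta w t) T).
rewrite -ExD; apply: le_Ex => [w s x|w].
  by apply: pk_ge0 => // j; have /andP[? ?] := th j; rewrite !ltW.
rewrite addrC (le_trans (expR_ge1Dx _))// expRD mulrC ler_wpM2l ?expR_ge0//.
rewrite /off_k; case: eqP => _ /=; first by rewrite !mulr0 expR0 addr0.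
by rewrite !mulr1 lerDr.
Qed.

End Policy.

Lemma opt_armE (i0 : 'I_K) (theta : 'I_K -> R) b :
  (forall k, theta k <= theta b) -> theta (opt_arm i0 theta) = theta b.
Proof.
move=> tb; apply/eqP; rewrite eq_le tb /= /opt_arm.
by case: Order.TotalTheory.arg_maxP => //= i _; apply.
Qed.

(* Only rounds among the last [m] have an incompletely collected reward, and
   each of them contributes at most 1 to the difference. *)
Lemma delayed_sum_ge T (g : nat -> R) : (forall s, 0 <= g s <= 1) ->
  tau m * (\sum_(s < T) g s) - m%:R <=
  \sum_(t < T) \sum_(t - m <= s < t.+1) dmass tau (t - s) * g s.
Proof.
move=> g01.
have tau1 : tau m <= 1 by case: tau_cdf => _ [_ []].
have tau0 : 0 <= tau m by case: tau_cdf.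
(* Exchanging the sums lets each round [s] collect the delay masses of the window from [s] to
   [s + m], cut at the horizon. *)
have -> : \sum_(t < T) \sum_(t - m <= s < t.+1) dmass tau (t - s) * g s =
    \sum_(s < T) g s *
      \sum_(0 <= t < T | (s <= t < s + m.+1)%N) dmass tau (t - s).
  rewrite (eq_bigr (fun t : 'I_T => \sum_(s < T)
     if (s <= t < s + m.+1)%N then dmass tau (t - s) * g s else 0)).
    rewrite exchange_big; apply: eq_bigr => s _.
    rewrite big_mkord mulr_sumr [in RHS]big_mkcond; apply: eq_bigr => t _.
    by case: ifP; rewrite // mulrC.
  move=> t _; rewrite (big_nat_widenl _ 0)// (big_nat_widen _ _ T)//.
  rewrite big_mkord big_mkcond; apply: eq_bigr => s _.
  by rewrite /= ltnS addnS ltnS leq_subLR addnC andbC.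
rewrite lerBlDr.
have mE : \sum_(0 <= s < T | (T - m <= s)%N) 1 <= m%:R :> R.
  rewrite -(big_nat_widenl _ _ _ predT)// sumr_const_nat ler_nat.
  by rewrite leq_subLR addnC -leq_subLR.
apply: le_trans (lerD (lexx _) mE).
rewrite big_mkord [X in _ + X]big_mkcond -big_split mulr_sumr.
apply: ler_sum => s _ /=.
have /andP[g0 g1] := g01 s.
(* A late round is charged 1, which exceeds its full share [tau m * g s]. For an earlier round the
   window fits below [T], so the collected mass is exactly [tau m]. *)
case: leqP => Tms.
  rewrite -[leLHS]add0r lerD ?mulr_ile1//.
  by rewrite mulr_ge0// sumr_ge0// => t _; apply: dmass_ge0.
have sT : (s + m.+1 <= T)%N by rewrite addnS -ltn_subRL ltn_subCr.
rewrite addr0 mulrC (_ : \sum_(0 <= t < T | _) _ = tau m)//.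
transitivity (\sum_(s <= t < s + m.+1) dmass tau (t - s)).
  by apply/esym; rewrite (big_nat_widenl _ 0)// (big_nat_widen _ _ T).
rewrite -[X in \sum_(X <= _ < _) _]add0n big_addn addKn big_mkord -sum_dmass.
by apply: eq_bigr => d _; rewrite addnK.
Qed.

(** The oracle's rewards are delayed by the same law, so the regret is the delayed sum of the
    expected gaps [g s], to which [delayed_sum_ge] applies. *)
Lemma regret_ge (i0 b : 'I_K) (theta : 'I_K -> R) (pol : policy K) T :
  (forall k, 0 <= theta k <= 1) -> (forall k, theta k <= theta b) ->
  tau m * (\sum_k (theta b - theta k) * plays pol theta T k) - m%:R
  <= regret m i0 theta tau pol T.
Proof.
move=> th tb.
pose g s := theta b - Ex (pk (m := m) tau pol theta) T (fun w => theta (arm pol w s)).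
have p0 w t x : 0 <= pk (m := m) tau pol theta w t x by apply: pk_ge0.
have p1 w t : \sum_x pk (m := m) tau pol theta w t x = 1 by apply: pk_sum1.
have -> : regret m i0 theta tau pol T =
    \sum_(t < T) \sum_(t - m <= s < t.+1) dmass tau (t - s) * g s.
  rewrite /regret !exp_rewardE -sumrB; apply: eq_bigr => t _.
  rewrite -sumrB; apply: eq_bigr => s _.
  rewrite -mulrBr; congr (_ * (_ - _)).
  rewrite /arm Ex_cst; first exact: opt_armE.
  by move=> w u; apply: pk_sum1.
have -> : \sum_k (theta b - theta k) * plays pol theta T k = \sum_(s < T) g s.
  under eq_bigr => k _ do rewrite -ExZ.
  rewrite -Ex_sum /g.
  under [RHS]eq_bigr => s _ do rewrite -{1}(Ex_cst p1 T (theta b)) -ExB.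
  rewrite -Ex_sum; apply: eq_Ex => w.
  under eq_bigr => k _ do rewrite mulr_sumr.
  rewrite exchange_big; apply: eq_bigr => s _.
  rewrite (bigD1 (arm pol w s)) //= eqxx mulr1 big1 ?addr0// => k.
  by rewrite eq_sym => /negbTE ->; rewrite mulr0.
apply: delayed_sum_ge => s; rewrite /g subr_ge0; apply/andP; split.
  by rewrite -[leRHS](Ex_cst p1 T); apply: le_Ex.
have : 0 <= Ex (pk (m := m) tau pol theta) T (fun w => theta (arm pol w s)).
  rewrite -(Ex0 (pk (m := m) tau pol theta) T); apply: le_Ex => // w.
  by have /andP[] := th (arm pol w s).
by have /andP[_] := th b; lra.
Qed.

End RegretBounds.

(** * Asymptotics *)

Lemma limn_einf_ge (R : realType) (u : (\bar R)^nat) (l : \bar R) :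
  (\forall n \near \oo, l <= u n)%E -> (l <= limn_einf u)%E.
Proof.
move=> [N _ lu]; rewrite limn_einf_lim (cvg_lim _ (@cvg_einfs_sup _ u))//.
apply: (@le_trans _ _ (einfs u N)).
  by apply/le_ereal_inf_tmp => _ [n /= Nn <-]; exact: lu.
by apply: ereal_sup_ubound; exists N.
Qed.

Lemma powR_nat_near (R : realType) (alpha c : R) : 0 < alpha -> 0 <= c ->
  \forall T \near \oo, c <= T%:R `^ alpha.
Proof.
move=> a0 c0; near=> T.
have -> : c = (c `^ alpha^-1) `^ alpha by rewrite -powRrM mulVf ?powRr1// gt_eqF.
apply: ge0_ler_powR; rewrite ?nnegrE ?powR_ge0 ?ler0n ?(ltW a0)//.
by near: T; exact: nbhs_infty_ger.
Unshelve. all: by end_near. Qed.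

Lemma ln_nat_near (R : realType) (c : R) : \forall T \near \oo, c <= ln (T%:R : R).
Proof.
near=> T.
have eT : expR c <= T%:R by near: T; exact: nbhs_infty_ger.
by rewrite -[leLHS]expRK ler_ln// posrE ?expR_gt0// (lt_le_trans _ eT)// expR_gt0.
Unshelve. all: by end_near. Qed.

Lemma continuous_kl_r (R : realType) (t p q : R) :
  0 < t <= 1 -> 0 < p < 1 -> 0 < q < 1 ->
  kl (t * p) (t * x) @[x --> q] --> kl (t * p) (t * q).
Proof.
move=> /andP[t0 t1] /andP[p0 p1] /andP[q0 q1].
have lt1 x : x < 1 -> 0 < x -> 0 < 1 - t * x.
  by move=> x1 x0; rewrite subr_gt0 (le_lt_trans _ x1)// ler_piMl// ltW.
have tx : t * x @[x --> q] --> t * q by apply: cvgM => //; exact: cvg_cst.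
apply: cvgD; apply: cvgM; try exact: cvg_cst.
  apply: continuous_cvg; first by apply: continuous_ln; rewrite divr_gt0 ?mulr_gt0.
  apply: cvgM; first exact: cvg_cst.
  by apply: cvgV => //; rewrite gt_eqF// mulr_gt0.
apply: continuous_cvg; first by apply: continuous_ln; rewrite divr_gt0 ?lt1.
apply: cvgM; first exact: cvg_cst.
apply: cvgV => //; first by rewrite gt_eqF// lt1.
by apply: cvgB => //; exact: cvg_cst.
Qed.

Section Asymptotics.
Variables (R : realType) (K m : nat) (i0 : 'I_K).
Variables (tau : nat -> R) (pol : policy K).
Hypothesis tau_cdf : is_cdf tau.
Hypothesis tau_gt0 : 0 < tau m.
Hypothesis efficient : uniformly_efficient m i0 tau pol.
Local Notation plays := (plays m tau pol).

Lemma sum_plays_off (theta : 'I_K -> R) T b :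
  T%:R - plays theta T b = \sum_(k | k != b) plays theta T k.
Proof.
have := sum_plays m tau pol theta T; rewrite (bigD1 b)//= => <-.
by rewrite addrAC subrr add0r.
Qed.

Lemma suboptimal_plays_near (theta : 'I_K -> R) (b : 'I_K) (delta alpha e : R) :
  (forall k, 0 <= theta k <= 1) -> 0 < delta ->
  (forall k, k != b -> theta k + delta <= theta b) ->
  0 < alpha < 1 -> 0 < e ->
  \forall T \near \oo, T%:R - plays theta T b <= e * T%:R `^ alpha.
Proof.
move=> th d0 gap a01 e0.
have [a0 a1] := andP a01.
have td : 0 < tau m * delta by rewrite mulr_gt0.
(* Half of the budget pays for the regret, the other half for the constant [m] lost to delays. *)
pose c := tau m * delta * e / 2.
have c0 : 0 < c by rewrite divr_gt0// mulr_gt0.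
near=> T.
have mT : m%:R / c <= T%:R `^ alpha.
  by near: T; apply: powR_nat_near => //; rewrite divr_ge0// ltW.
have T0 : 0 < T%:R `^ alpha.
  rewrite powR_gt0//; near: T; apply: filterS (nbhs_infty_ger 1) => T.
  exact: lt_le_trans.
have : `|regret m i0 theta tau pol T / T%:R `^ alpha| < c.
  by near: T; apply: cvgr0_norm_lt => //; exact: efficient.
move=> /ltr_normlW; rewrite ltr_pdivrMr// => /ltW rT.
move: mT; rewrite ler_pdivrMr// mulrC => mT.
have tb k : theta k <= theta b.
  by have [->//|/gap kb] := eqVneq k b; rewrite (le_trans _ kb)// lerDl ltW.
have := regret_ge m tau_cdf i0 pol T th tb.
rewrite lerBlDr => /le_trans /(_ (lerD rT mT)).
have dle : delta * (T%:R - plays theta T b) <=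
    \sum_k (theta b - theta k) * plays theta T k.
  rewrite sum_plays_off mulr_sumr.
  rewrite [leRHS](bigD1 b)//= subrr mul0r add0r; apply: ler_sum => k /gap kb.
  by rewrite ler_wpM2r// ?plays_ge0// lerBrDl.
move=> sle; rewrite -(ler_pM2l td) -[leLHS]mulrA.
apply: (le_trans (ler_wpM2l (ltW tau_gt0) dle)).
apply: (le_trans sle); rewrite le_eqVlt; apply/orP; left; apply/eqP.
by rewrite /c; field.
Unshelve. all: by end_near. Qed.

Variables (theta : 'I_K -> R) (b : 'I_K).
Hypothesis th : forall k, 0 < theta k < 1.
Hypothesis opt : forall k, k != b -> theta k < theta b.

Let th_le : forall k, 0 <= theta k <= 1.
Proof. by move=> k; have /andP[? ?] := th k; rewrite !ltW. Qed.

(** The constant [u] stands for any value below the inverse divergence; the strict inequality leaves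
    room both to perturb the rate of arm [k] and to choose [alpha]. *)
Lemma plays_near (k : 'I_K) (u : R) : k != b -> 0 < u ->
  0 < kl (tau m * theta k) (tau m * theta b) ->
  u * kl (tau m * theta k) (tau m * theta b) < 1 ->
  \forall T \near \oo, u * ln T%:R <= plays theta T k.
Proof.
move=> kb u0 D0 uD0.
have tau1 : tau m <= 1 by case: tau_cdf => _ [_ []].
have [tb0 tb1] := andP (th b).
have cD : kl (tau m * theta k) (tau m * x) @[x --> (theta b)^'+] -->
    kl (tau m * theta k) (tau m * theta b).
  by apply: cvg_at_right_filter; apply: continuous_kl_r; rewrite ?tau_gt0.
(* The new rate [x] of arm [k] exceeds that of [b], making [k] optimal under [theta'], yet is close
   enough by continuity to keep u D < 1. *)
have /filter_ex [x [bx x1 D_gt0 uD]] : \forall x \near (theta b)^'+,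
    [/\ theta b < x, x < 1, 0 < kl (tau m * theta k) (tau m * x) &
        u * kl (tau m * theta k) (tau m * x) < 1].
  near=> x; split; near: x.
  - exact: nbhs_right_gt.
  - exact: nbhs_right_lt.
  - exact: cvgr_gt cD _ D0.
  - by apply: cvgr_lt uD0; apply: cvgM => //; exact: cvg_cst.
set D := kl _ _ in D_gt0 uD; clear D0 uD0.
pose theta' j := if j == k then x else theta j.
have th'k : theta' k = x by rewrite /theta' eqxx.
have th' j : 0 < theta' j < 1.
  by rewrite /theta'; case: eqP => // _; rewrite x1 (lt_trans tb0 bx).
have /filter_ex [d [d0 gap]] : \forall d \near (0 : R)^'+,
    0 < d /\ forall j, j != b -> theta j + d <= theta b.
  near=> d; split; near: d; first exact: nbhs_right_gt.
  apply: filter_forall => j.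
  have [jb|jb] := eqVneq j b; first by near=> d.
  near=> d => _; rewrite -lerBrDl; near: d; apply: nbhs_right_le.
  by rewrite subr_gt0 opt.
(* A third of the slack, so that u D = 1 - 3 alpha: squaring 1 - alpha costs at most 2 alpha, and
   the additive constant 1 is at most alpha ln T. *)
pose alpha := (1 - u * D) / 3.
have uD_gt0 : 0 < u * D by rewrite mulr_gt0.
have a01 : 0 < alpha < 1 by apply/andP; split; rewrite /alpha; lra.
have [a0 a1] := andP a01.
near=> T.
have Tb : T%:R - plays theta T b <= alpha * T%:R `^ alpha.
  by near: T; apply: (suboptimal_plays_near th_le d0).
have Tk : T%:R - plays theta' T k <= 1 * T%:R `^ alpha.
  near: T; apply: (@suboptimal_plays_near _ _ (x - theta b)) => //.
  - by move=> j; have /andP[? ?] := th' j; rewrite !ltW.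
  - by rewrite subr_gt0.
  - move=> j jk; rewrite th'k /theta' (negbTE jk) addrCA gerDl subr_le0.
    by have [->//|/opt/ltW] := eqVneq j b.
have T1 : 1 <= T%:R :> R by near: T; exact: nbhs_infty_ger.
have lT : 1 / alpha <= ln (T%:R : R) by near: T; exact: ln_nat_near.
have T0 : 0 < T%:R :> R by exact: lt_le_trans T1.
have lT0 : 0 <= ln (T%:R : R) by exact: ln_ge0.
have Talpha : T%:R `^ alpha <= T%:R :> R.
  by rewrite -[leRHS]powRr1 ?ler0n// ler_powR// ltW.
(* Under [theta] arm [k] is suboptimal, so efficiency makes all but a small fraction of the rounds
   differ from [k]. *)
have kT : plays theta T k <= alpha * T%:R.
  apply: le_trans (_ : T%:R - plays theta T b <= _); last first.
    by rewrite (le_trans Tb)// ler_wpM2l// ltW.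
  rewrite sum_plays_off (bigD1 k)//= lerDl sumr_ge0// => j _.
  exact: plays_ge0.
(* With a = (1 - alpha) ln T, the weight exp(a) turns the T^alpha bound on rounds off [k] under
   [theta'] into exactly T, which the common factor T then cancels. *)
have expa : expR ((1 - alpha) * ln T%:R) * T%:R `^ alpha = T%:R :> R.
  by rewrite /powR gt_eqF// -expRD -mulrDl subrK mul1r lnK.
have := exploration_bound tau_cdf pol ((1 - alpha) * ln T%:R) T tau_gt0 th th' _.
move=> /(_ k); rewrite th'k -/D => bound.
have {}bound : (1 - alpha) * ln T%:R * (T%:R - plays theta T k) -
    T%:R * (D * plays theta T k) <= T%:R.
  apply: (le_trans (bound _)) => [j|]; first by rewrite /theta' => /negbTE ->.
  by rewrite -[leRHS]expa ler_wpM2l ?expR_ge0// -[leRHS]mul1r.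
have {}bound : T%:R * ((1 - alpha) * ln T%:R * (1 - alpha) - D * plays theta T k)
    <= T%:R * 1.
  rewrite mulr1 (le_trans _ bound)// mulrBr lerB// mulrCA.
  rewrite ler_wpM2l ?mulr_ge0 ?subr_ge0 ?(ltW a1)//.
  by rewrite mulrBr mulr1 lerB// mulrC.
rewrite ler_pM2l// in bound.
rewrite -(ler_pM2l D_gt0).
have : 1 <= alpha * ln T%:R by rewrite mulrC -ler_pdivrMr.
have -> : D * (u * ln T%:R) = (1 - 3 * alpha) * ln T%:R by rewrite /alpha; field.
have : 0 <= alpha * alpha * ln T%:R by rewrite mulr_ge0// mulr_ge0// (ltW a0).
lra.
Unshelve. all: by end_near. Qed.

End Asymptotics.

Theorem theorem3 (R : realType) (K m : nat) (best : 'I_K)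
  (theta : 'I_K -> R) (tau : nat -> R) (pol : policy K) :
  (1 <= m)%N ->
  (forall k, 0 < theta k < 1) ->
  (forall k, k != best -> theta k < theta best) ->
  is_cdf tau ->
  0 < tau m ->
  uniformly_efficient m best tau pol ->
  ((\sum_(k < K | k != best)
      tau m * (theta best - theta k) / kl (tau m * theta k) (tau m * theta best))%:E
  <= limn_einf (fun T : nat => (regret m best theta tau pol T / ln (T%:R : R))%:E))%E.
Proof.
move=> _ th opt tau_cdf tau0 eff.
set D := fun k => kl (tau m * theta k) (tau m * theta best).
have th_le k : 0 <= theta k <= 1 by have /andP[? ?] := th k; rewrite !ltW.
have tb k : theta k <= theta best by have [->//|/opt/ltW] := eqVneq k best.
pose gap k := tau m * (theta best - theta k).
have gap_gt0 k : k != best -> 0 < gap k by move=> /opt ?; rewrite mulr_gt0// subr_gt0.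
have arm_near eta k : 0 < eta -> k != best ->
    \forall T \near \oo,
      (gap k / D k - eta) * ln T%:R <= gap k * plays m tau pol theta T k.
  move=> eta0 kb; have gk := gap_gt0 _ kb.
  (* A nonpositive constant makes the bound trivial, as counts and gaps are nonnegative. *)
  have [v0|v0] := leP (gap k / D k - eta) 0.
    near=> T; have T1 : 1 <= T%:R :> R by near: T; exact: nbhs_infty_ger.
    rewrite (@le_trans _ _ 0)//; first by rewrite mulr_le0_ge0// ln_ge0.
    by rewrite mulr_ge0 ?(ltW gk)// plays_ge0.
  (* Division by zero gives 0, so a quotient above [eta] forces a positive divergence. *)
  have Dk : 0 < D k.
    rewrite ltNge; apply/negP => Dk; move: v0; rewrite subr_gt0 => v0.
    have : gap k / D k <= 0 by rewrite mulr_ge0_le0 ?(ltW gk)// invr_le0.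
    by rewrite leNgt (lt_trans eta0 v0).
  (* Here u = (gap / D - eta) / gap, so u D = 1 - eta D / gap is below 1. *)
  have := plays_near tau_cdf tau0 eff th opt kb (divr_gt0 v0 gk) Dk.
  rewrite -/(D k) (_ : _ * D k = 1 - eta * D k / gap k); last first.
    by move: (gap k) (D k) gk Dk => g d g0 d0; field; rewrite !gt_eqF.
  rewrite ltrBlDr ltrDl divr_gt0 ?(mulr_gt0 eta0 Dk)// => /(_ isT).
  apply: filterS => T; rewrite mulrAC ler_pdivrMr// [leRHS]mulrC; exact.
apply/lee_addgt0Pr => e e0; rewrite -leeBlDr// -EFinB.
apply: limn_einf_ge.
(* The error [e] is split into [K] shares, enough for all suboptimal arms, and one more for the
   delay term [m]. *)
pose eta := e / K.+1%:R.
have eta0 : 0 < eta by rewrite divr_gt0.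
near=> T.
have T1 : expR 1 <= T%:R :> R by near: T; exact: nbhs_infty_ger.
have lT : 0 < ln (T%:R : R).
  by rewrite ln_gt0// (lt_le_trans _ T1)// expR_gt1.
have mT : m%:R <= eta * ln (T%:R : R).
  by rewrite mulrC -ler_pdivrMr//; near: T; exact: ln_nat_near.
have armT : forall k, k != best ->
    (gap k / D k - eta) * ln T%:R <= gap k * plays m tau pol theta T k.
  near: T; apply: filter_forall => k; have [kb|kb] := eqVneq k best.
    by near=> T.
  by near do move=> _; exact: arm_near.
rewrite lee_fin ler_pdivlMr//.
apply: le_trans (regret_ge m tau_cdf best pol T th_le tb).
rewrite lerBrDr mulr_sumr [leRHS](bigD1 best)//= subrr mul0r mulr0 add0r.
under [leRHS]eq_bigr => k _ do rewrite mulrA.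
apply: (le_trans _ (ler_sum _ armT)).
rewrite -mulr_suml sumrB [X in _ <= (_ - X) * _]sumr_const.
apply: (le_trans (lerD (lexx _) mT)).
rewrite -mulrDl ler_wpM2r ?(ltW lT)// -addrA lerD2l lerNr opprD opprK.
have cK : (#|[pred k | k != best]| <= K)%N by rewrite -[leqRHS]card_ord max_card.
apply: (@le_trans _ _ (eta *+ K)); first by rewrite ler_wpMn2l// ltW.
by rewrite lerBrDr -mulrSr -mulr_natr /eta divfK.
Unshelve. all: by end_near. Qed.
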